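(* Let $p\ge 2$ and $d\ge 1$ be integers. There is a constant $C_{p,d}$ depending only on $p$ and $d$ such that every $(d-1)$-dimensional simplicial complex $\Gamma$ with $n$ vertices and $\mathrm{gr}_{p-1}(\Gamma)>2p$ satisfies $f_{p-1}(\Gamma)\le C_{p,d}\,n^{\,p-1/2^{p-1}}$.
   Context: A simplicial complex $\Gamma$ on a finite vertex set $V=V(\Gamma)$ is a family of subsets of $V$ (faces) closed under taking subsets; its dimension is $\max\{|F|:F\in\Gamma\}-1$; $f_j(\Gamma)$ is the number of faces with $j+1$ elements. For $W\subseteq V$, $\Gamma[W]=\{F\in\Gamma:F\subseteq W\}$; for a face $F$ (possibly empty), $\mathrm{lk}_\Gamma(F)=\{G\setminus F: F\subseteq G\in\Gamma\}$. Fix a field $\mathbf{k}$; $\tilde H_j(\cdot;\mathbf{k})$ is reduced simplicial homology. The $(p-1)$-girth is $\mathrm{gr}_{p-1}(\Gamma)=\min\{|W|: W\subseteq V(\Gamma),\ \tilde H_{p-1}(\mathrm{lk}_\Gamma(F)[W];\mathbf{k})\neq 0 \text{ for some face } F\in\Gamma \text{ (including } F=\emptyset)\}$, or $\infty$ if none exists. *)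

(* Defs.v *)
From HB Require Import structures.
From mathcomp Require Import all_boot all_order all_algebra.
Set Implicit Arguments. Unset Strict Implicit. Unset Printing Implicit Defensive.
Import GRing.Theory.

Section Complexes.
Variable T : finType.

Definition simplicial_complex (G : {set {set T}}) : Prop :=
  forall F H : {set T}, F \in G -> H \subset F -> H \in G.

(* dim G = d - 1, i.e. max{|F| : F in G} = d. *)
Definition has_max_face_size (G : {set {set T}}) (d : nat) : Prop :=
  (forall F, F \in G -> #|F| <= d) /\ exists2 F, F \in G & #|F| = d.

Definition faces_sz (G : {set {set T}}) (m : nat) : {set {set T}} :=
  [set F in G | #|F| == m]%N.

Definition fvec (G : {set {set T}}) (j : nat) : nat := #|faces_sz G j.+1|.

Definition induced (G : {set {set T}}) (W : {set T}) : {set {set T}} :=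
  [set F in G | F \subset W].

Definition link (G : {set {set T}}) (F : {set T}) : {set {set T}} :=
  [set H :\: F | H in G & F \subset H].

(* Reduced simplicial chain complex over k (row-vector convention, vertices
   ordered by enum_rank).  bd G j : C_j -> C_{j-1}, where C_j has basis the
   faces with j+1 elements (C_{-1} spanned by the empty face: reduced homology). *)
Local Open Scope ring_scope.
Definition bd (k : fieldType) (G : {set {set T}}) (j : nat)
  : 'M[k]_(#|faces_sz G j.+1|, #|faces_sz G j|) :=
  \matrix_(a, b)
    let F : {set T} := enum_val a in let H : {set T} := enum_val b in
    \sum_(v : T | (v \in F) && (H == F :\ v))
       (-1 : k) ^+ #|[set u in F | (enum_rank u < enum_rank v)%N]|.

Local Close Scope ring_scope.

Definition homology_nonzero (k : fieldType) (G : {set {set T}}) (j : nat) : bool :=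
  ~~ (kermx (bd k G j) <= bd k G j.+1)%MS.

Definition girth_witness (k : fieldType) (G : {set {set T}}) (j : nat) (W : {set T}) : bool :=
  [exists F in G, homology_nonzero k (induced (link G F) W) j].

(* gr_j(G) : None stands for infinity *)
Definition girth (k : fieldType) (G : {set {set T}}) (j : nat) : option nat :=
  if [exists W, girth_witness k G j W]
  then Some (\big[minn/#|T|.+1]_(W | girth_witness k G j W) #|W|)
  else None.

Definition girth_gt (k : fieldType) (G : {set {set T}}) (j m : nat) : Prop :=
  match girth k G j with None => True | Some g => m < g end.

End Complexes.

From Stdlib Require Import Reals.

Definition bound_rhs (C : R) (n p : nat) : R :=
  (C * Rpower (INR n) (INR p - / (2 ^ (p - 1))))%R.

(* Main.v *)
Require Import Defs.
From HB Require Import structures.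
From mathcomp Require Import all_boot all_order all_algebra.
From mathcomp Require Import zify.
From Stdlib Require Import Classical.

Set Implicit Arguments. Unset Strict Implicit. Unset Printing Implicit Defensive.
Import GRing.Theory.

(** The proof runs Erdos' induction for complete [p]-partite hypergraphs, but
    instead of a complete hypergraph it carries a homology class.  A stage
    consists of a face [F], a set [W] with [#|W| <= 2 e], a complex [D] on [W]
    with nonzero homology in dimension [e - 1], and many sets [S] of size
    [q = p - e] with [lk(F + S)[W] = D].  Fix [S'] of size [q - 1] and let [A]
    consist of [d + 1] vertices [v] such that [S' + v] is one of these sets.
    If [lk(F + S')[W + R]] were acyclic in dimension [e + |R| - 2] for all
    [R] in [A] with [|R| >= 2], then passing successively to the links of the
    vertices of [A] would show that [A] is a face, contradicting the bound on
    the dimension.  So many [R] of some common size [r] carry homology; fixing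
    [R], the induced complex on [W + R] and [r - 2] vertices of [S'], which are
    moved into [F], gives a stage with [e + r - 1] and [q - r + 1].  The density
    exponent is multiplied by [r <= 2^(r-1)], which is exactly what the
    bound allows for the smaller [q].  Homology above dimension [p - 1] is
    excluded as well, since it descends to links. *)

(** * Chains and acyclicity *)

Section Chains.
Variables (k : fieldType) (T : finType).
Implicit Types (A F R U W V : {set T}) (K G : {set {set T}}) (u v : T).
Local Notation chain := {ffun {set T} -> k}.
Implicit Types a b c z : chain.
Local Open Scope ring_scope.

(** [v] itself is never counted, so this is the sign of [v] both in [A] and in [v |: A], in
    agreement with [bd]. *)
Definition pos_sign v A : k :=
  (-1) ^+ #|[set u in A | (enum_rank u < enum_rank v)%N]|.

(* Chains are indexed by the size of their faces, one more than the dimension,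
   so that size 0 is the augmentation of reduced homology. *)
Definition bnd (c : chain) : chain :=
  [ffun A : {set T} => \sum_(v | v \notin A) pos_sign v A * c (v |: A)].

Definition cone v (c : chain) : chain :=
  [ffun A : {set T} => if v \in A then pos_sign v (A :\ v) * c (A :\ v) else 0].

(** If [c] is split into a cone from [v] and a chain on sets avoiding [v], this is the base of the
    cone, a chain on the link of [v]. *)
Definition contr v (c : chain) : chain :=
  [ffun A : {set T} => if v \in A then 0 else pos_sign v A * c (v |: A)].

Lemma pos_sign_sq v A : pos_sign v A * pos_sign v A = 1.
Proof. by rewrite /pos_sign -expr2 sqrr_sign. Qed.

Lemma pos_signU u v A : u \notin A ->
  pos_sign v (u |: A) = (-1) ^+ (enum_rank u < enum_rank v)%N * pos_sign v A.
Proof.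
move=> uA; rewrite /pos_sign -exprD; congr (_ ^+ _).
case: ltnP => uv /=.
  have -> : [set w in u |: A | (enum_rank w < enum_rank v)%N]
    = u |: [set w in A | (enum_rank w < enum_rank v)%N].
    apply/setP => w; rewrite !inE; case: eqP => //= ->; by rewrite uv.
  by rewrite cardsU1 !inE (negPf uA).
rewrite add0n; apply: eq_card => w; rewrite !inE.
by case: eqP => //= ->; rewrite ltnNge uv andbF.
Qed.

(** Exactly one of [u], [v] precedes the other, so exactly one of the two sides picks up a sign. *)
Lemma pos_sign_swap u v A : u != v -> u \notin A -> v \notin A ->
  pos_sign u A * pos_sign v (u |: A) = - (pos_sign v A * pos_sign u (v |: A)).
Proof.
move=> uv uA vA; rewrite !pos_signU //.
have : enum_rank u != enum_rank v by rewrite (inj_eq enum_rank_inj).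
rewrite -(inj_eq val_inj) /= neq_ltn.
case/orP => h; rewrite h ltnNge (ltnW h) /= ?expr0 ?expr1 ?mul1r;
  by rewrite ?mulN1r ?mulrN ?opprK mulrC.
Qed.

Lemma pos_signUU u v A : u != v -> u \notin A -> v \notin A ->
  pos_sign u (v |: A) * pos_sign v (u |: A) = - (pos_sign v A * pos_sign u A).
Proof.
move=> uv uA vA; rewrite !pos_signU // mulrACA -mulNr.
have : enum_rank u != enum_rank v by rewrite (inj_eq enum_rank_inj).
rewrite -(inj_eq val_inj) /= neq_ltn mulrC [pos_sign u A * _]mulrC.
by case/orP => h; rewrite h ltnNge (ltnW h) /= ?expr0 ?expr1 ?mul1r ?mulr1 mulrN1 mulNr.
Qed.

(** The Leibniz rule for the join with [v]. Values of [c] at sets containing [v] are killed by the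
    cone on the left and cancel on the right. *)
Lemma bnd_cone v (c : chain) : bnd (cone v c) = c - cone v (bnd c).
Proof.
apply/ffunP => A; rewrite !ffunE; case: ifPn => vA; last first.
  rewrite (bigD1 v) //= !ffunE setU11 setU1K // mulrA pos_sign_sq mul1r.
  rewrite big1 ?subr0 ?addr0 // => u /andP [uA uv].
  by rewrite !ffunE in_setU1 eq_sym (negPf uv) (negPf vA) mulr0.
set B := A :\ v; have vB : v \notin B by rewrite !inE eqxx.
have AE : A = v |: B by rewrite setD1K.
rewrite [in RHS](bigD1 v) //= -AE mulrDr mulrA pos_sign_sq mul1r opprD addrA subrr add0r.
rewrite big_distrr /= -sumrN; apply: eq_big => [u|u uA].
  by rewrite AE !inE negb_or andbC.
have uv : u != v by apply: contraNneq uA => ->.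
have uB : u \notin B by rewrite inE (negPf uA) andbF.
rewrite !ffunE in_setU1 vA orbT.
have -> : (u |: A) :\ v = u |: B.
  by apply/setP => w; rewrite AE !inE; case: (eqVneq w v) => [->|]; rewrite ?(eq_sym v) ?(negPf uv).
by rewrite !mulrA AE -mulNr -pos_signUU.
Qed.

Lemma contr_bnd v (c : chain) : contr v (bnd c) = - bnd (contr v c).
Proof.
apply/ffunP => A; rewrite !ffunE; case: ifPn => vA.
  by rewrite big1 ?oppr0 // => u uA; rewrite !ffunE in_setU1 vA orbT mulr0.
rewrite [in RHS](bigD1 v) //= !ffunE setU11 mulr0 add0r big_distrr -sumrN /=.
apply: eq_big => [u|u]; first by rewrite !inE negb_or andbC.
rewrite !inE negb_or => /andP [uv uA].
rewrite !ffunE in_setU1 eq_sym (negPf uv) (negPf vA) /= !mulrA setUCA.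
by rewrite -mulNr -pos_sign_swap // eq_sym.
Qed.

Lemma bndD (a b : chain) : bnd (a + b) = bnd a + bnd b.
Proof.
by apply/ffunP => A; rewrite !ffunE -big_split; apply: eq_bigr => u _; rewrite ffunE mulrDr.
Qed.

Lemma bndN (a : chain) : bnd (- a) = - bnd a.
Proof.
by apply/ffunP => A; rewrite !ffunE -sumrN; apply: eq_bigr => u _; rewrite ffunE mulrN.
Qed.

Lemma bnd0 : bnd 0 = 0.
Proof. by apply/ffunP => A; rewrite !ffunE big1 // => u _; rewrite ffunE mulr0. Qed.

Lemma cone0 v : cone v 0 = 0.
Proof. by apply/ffunP => A; rewrite !ffunE mulr0 if_same. Qed.

Lemma contrD v (a b : chain) : contr v (a + b) = contr v a + contr v b.
Proof. by apply/ffunP => A; rewrite !ffunE; case: ifP; rewrite ?addr0 ?mulrDr. Qed.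

Lemma contrN v (a : chain) : contr v (- a) = - contr v a.
Proof. by apply/ffunP => A; rewrite !ffunE; case: ifP; rewrite ?oppr0 ?mulrN. Qed.

Definition on K (m : nat) (c : chain) := forall A, c A != 0 -> A \in K /\ #|A| = m.

Lemma onS K K' m c : on K m c -> (forall A, A \in K -> A \in K') -> on K' m c.
Proof. by move=> h s A /h [/s]. Qed.

Lemma onD K m a b : on K m a -> on K m b -> on K m (a + b).
Proof.
move=> ha hb A; rewrite ffunE => h; have [a0|/ha //] := eqVneq (a A) 0.
by apply: hb; rewrite a0 add0r in h.
Qed.

Lemma onN K m a : on K m a -> on K m (- a).
Proof. by move=> h A; rewrite ffunE oppr_eq0 => /h. Qed.

Lemma onB K m a b : on K m a -> on K m b -> on K m (a - b).
Proof. by move=> ha hb; apply/onD/onN. Qed.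

Lemma linkP K F A :
  reflect ([disjoint A & F] /\ A :|: F \in K) (A \in link K F).
Proof.
apply: (iffP imsetP) => [[H]|[d AK]].
  rewrite inE => /andP [HK FH] ->; rewrite -setI_eq0 setIDAC -setIDA setDv setI0 eqxx.
  by rewrite setUC setDE setUIr setUCr setIT (setUidPr FH).
exists (A :|: F); first by rewrite inE AK subsetUr.
by rewrite setDUl setDv setU0; apply/esym/setDidPl.
Qed.

Lemma inducedP K U A : reflect (A \in K /\ A \subset U) (A \in induced K U).
Proof. by rewrite inE; apply: andP. Qed.

Lemma link1P K v A : reflect (v \notin A /\ v |: A \in K) (A \in link K [set v]).
Proof.
apply: (iffP (linkP _ _ _)) => -[]; rewrite disjoint_sym disjoints1 setUC; by split.
Qed.

Lemma link_complex K F : simplicial_complex K -> simplicial_complex (link K F).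
Proof.
move=> cK A B /linkP [dA AK] BA; apply/linkP; split; first exact: disjointWl dA.
by apply: cK AK _; apply: setSU.
Qed.

Lemma sub_link K F A : simplicial_complex K -> A \in link K F -> A \in K.
Proof. by move=> cK /linkP [_ h]; apply: cK h (subsetUl _ _). Qed.

Lemma on_cone K U m v c : v \notin U ->
  on (induced (link K [set v]) U) m c -> on (induced K (v |: U)) m.+1 (cone v c).
Proof.
move=> vU hc A; rewrite ffunE; case: ifP => [vA|]; last by rewrite eqxx.
rewrite mulf_eq0 negb_or => /andP [_ /hc [/inducedP [/link1P [_ h] s] cA]].
rewrite setD1K // in h; split; last by rewrite (cardsD1 v A) vA cA.
by apply/inducedP; split=> //; rewrite -(setD1K vA) setUS.
Qed.

Lemma on_contr K U m v c : v \notin U ->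
  on (induced K (v |: U)) m.+1 c -> on (induced (link K [set v]) U) m (contr v c).
Proof.
move=> vU hc A; rewrite ffunE; case: ifPn => [|vA]; first by rewrite eqxx.
rewrite mulf_eq0 negb_or => /andP [_ /hc [/inducedP [h s] cA]].
split; last by move: cA; rewrite cardsU1 vA => -[].
apply/inducedP; split; first exact/link1P.
have := setSD [set v] s; rewrite setU1K // setU1K //.
Qed.

Lemma contr_cone v c : (forall A, c A != 0 -> v \notin A) -> contr v (cone v c) = c.
Proof.
move=> h; apply/ffunP => A; rewrite !ffunE setU11; case: ifPn => vA.
  by apply/esym/eqP; apply: contraTT vA => /h.
by rewrite setU1K // mulrA pos_sign_sq mul1r.
Qed.

Lemma contr_eq0 v c : (forall A, c A != 0 -> v \notin A) -> contr v c = 0.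
Proof.
move=> h; apply/ffunP => A; rewrite !ffunE; case: ifPn => vA //.
case: (eqVneq (c (v |: A)) 0) => [->|/h]; first by rewrite mulr0.
by rewrite setU11.
Qed.

Lemma on_notin K U m v c : v \notin U -> on (induced K U) m c ->
  forall A, c A != 0 -> v \notin A.
Proof. by move=> vU h A /h [/inducedP [_ /subsetP s] _]; apply: contra vU => /s. Qed.

(** Vanishing of reduced homology in dimension [m - 1], as [m] counts the vertices of a face. *)
Definition acyclic K m U := forall z, on (induced K U) m z -> bnd z = 0 ->
  exists2 c, on (induced K U) m.+1 c & bnd c = z.

Lemma on_link_induced K U m v c : simplicial_complex K ->
  on (induced (link K [set v]) U) m c -> on (induced K U) m c.
Proof.
move=> cK h; apply: onS h _ => A /inducedP [h s]; apply/inducedP; split=> //.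
exact: sub_link h.
Qed.

Lemma on_inducedS K U U' m c : U \subset U' ->
  on (induced K U) m c -> on (induced K U') m c.
Proof.
move=> s h; apply: onS h _ => A /inducedP [h s']; apply/inducedP; split=> //.
exact: subset_trans s' s.
Qed.

(** Exactness of H_m(K[r + U]) -> H_{m-1}(lk(r)[U]) -> H_{m-1}(K[U]), made explicit: a filling of
    [z] in [K] closes [cone r z] to a cycle, and the part at [r] of a filling of that cycle fills
    [z] up to sign. *)
Lemma acyclic_link K m U r : simplicial_complex K -> r \notin U ->
  acyclic K m.+1 (r |: U) -> acyclic K m U -> acyclic (link K [set r]) m U.
Proof.
move=> cK rU a1 a0 z zon z0.
have [b bon bE] := a0 z (on_link_induced cK zon) z0.
have [||c con cE] := a1 (cone r z - b).
- apply: onB; first exact: on_cone zon.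
  by apply: on_inducedS bon; apply: subsetUr.
- by rewrite bndD bndN bnd_cone z0 cone0 subr0 bE subrr.
exists (- contr r c); first exact/onN/on_contr.
rewrite bndN -contr_bnd cE contrD contrN contr_cone; last exact: on_notin zon.
by rewrite (contr_eq0 (c := b)) ?subr0 //; apply: on_notin bon.
Qed.

Lemma cone_contr v c A : cone v (contr v c) A = if v \in A then c A else 0.
Proof.
rewrite !ffunE; case: ifP => // vA.
by rewrite setD11 mulrA pos_sign_sq mul1r setD1K.
Qed.

Lemma on_rest K U m v c : on (induced K (v |: U)) m c ->
  on (induced K U) m (c - cone v (contr v c)).
Proof.
move=> con A; rewrite ffunE [X in _ + X]ffunE cone_contr.
case: ifPn => vA; first by rewrite subrr eqxx.
rewrite subr0 => /con [/inducedP [AK sA] cA]; split=> //.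
apply/inducedP; split=> //; apply/subsetP => x xA.
by have := subsetP sA x xA; rewrite in_setU1 => /predU1P [xv|//]; rewrite -xv xA in vA.
Qed.

(** The adjacent piece H_m(K[U]) -> H_m(K[u + U]) -> H_{m-1}(lk(u)[U]): the cone over a filling of
    the part of [z] at [u] moves [z] off [u]. *)
Lemma acyclic_step K m U u : simplicial_complex K -> u \notin U ->
  acyclic (link K [set u]) m U -> acyclic K m.+1 U -> acyclic K m.+1 (u |: U).
Proof.
move=> cK uU al ad z zon z0.
have cz0 : bnd (contr u z) = 0.
  by apply: oppr_inj; rewrite -contr_bnd z0 oppr0; apply: contr_eq0 => A; rewrite ffunE eqxx.
have [||c con cE] := al (contr u z) => //; first exact: on_contr.
have bE : bnd (cone u c) = c - cone u (contr u z) by rewrite bnd_cone cE.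
have [||b bon bbE] := ad (z + bnd (cone u c)).
- rewrite bE addrCA addrC; apply: onD; last exact: on_link_induced con.
  exact: on_rest.
- by rewrite bE !bndD bndN z0 add0r bnd_cone cz0 cone0 subr0 cE subrr.
exists (b - cone u c).
  apply: onB; last exact: on_cone con.
  by apply: on_inducedS bon; apply: subsetUr.
by rewrite bndD bndN bbE addrK.
Qed.

Lemma acyclic_set0 K m : acyclic K m.+1 set0.
Proof.
move=> z zon _; exists 0; first by move=> A; rewrite ffunE eqxx.
rewrite bnd0; apply/ffunP => A; rewrite ffunE; apply/esym/eqP.
case: (eqVneq (z A) 0) => // /zon [/inducedP [_]].
by rewrite subset0 => /eqP ->; rewrite cards0.
Qed.

(** The vertices of [U] are added one at a time to the empty set by [acyclic_step]. *)
Lemma acyclic_of_links K m n : simplicial_complex K ->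
  (forall v U, v \notin U -> (#|U| <= n)%N -> acyclic (link K [set v]) m U) ->
  forall U, (#|U| <= n.+1)%N -> acyclic K m.+1 U.
Proof.
move=> cK h U; elim: {U}_.+1 {-2}U (ltnSn #|U|) => // N IH U cU Un.
have [->|[u uU]] := set_0Vmem U; first exact: acyclic_set0.
move: cU Un; rewrite -(setD1K uU) cardsU1 setD11 add1n !ltnS => cU Un.
apply: acyclic_step; rewrite ?setD11 //; first by apply: h; rewrite ?setD11.
by apply: IH => //; apply: leqW.
Qed.

(* Induction on V: for r in V all hypotheses pass to the link of r, where the
   part at v of a chain filling the suspension r (z r) - v (z v) + b provides
   the new class at v, homologous there to z r. *)
Lemma mem_of_acyclic K W V e (z : T -> chain) : simplicial_complex K ->
  V != set0 -> [disjoint V & W] ->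
  (forall R, R \subset V -> (1 < #|R|)%N -> acyclic K (e + #|R|).-1 (W :|: R)) ->
  (forall v, v \in V -> [/\ on (induced (link K [set v]) W) e (z v), bnd (z v) = 0 &
     forall c, on (induced (link K [set v]) W) e.+1 c -> bnd c <> z v]) ->
  (forall u v, u \in V -> v \in V ->
     exists2 b, on (induced K W) e.+1 b & bnd b = z u - z v) ->
  V \in K.
Proof.
elim: {V}_.+1 {-2}V (ltnSn #|V|) K z => // N IH V cV K z cK /set0Pn [r rV] dV ac zP zh.
have rW : r \notin W by rewrite (disjointFr dV).
have [zron zr0 zrn] := zP r rV.
(* For a single vertex [r] it is enough that [z r] has a face in its support; it is nonzero because
   0 bounds. *)
have [V0|Vn0] := eqVneq (V :\ r) set0.
  have -> : V = [set r] by rewrite -(setD1K rV) V0 setU0.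
  have [zE|[A zA]] : z r = 0 \/ exists A, z r A != 0.
    have [/existsP|/existsPn h] := boolP [exists A, z r A != 0]; first by right.
    by left; apply/ffunP => A; rewrite ffunE; apply/eqP/negPn/h.
    by case: (zrn 0); rewrite ?bnd0 // => A; rewrite ffunE eqxx.
  have [/inducedP [/link1P [_ h] _] _] := zron _ zA.
  by apply: cK h _; rewrite sub1set setU11.
(* [zv.1] is the new class at [v] over the link of [r], and [zv.2] is a homology in that link
   between it and [z r]. *)
have step v : v \in V :\ r -> exists zv : chain * chain,
   [/\ on (induced (link (link K [set r]) [set v]) W) e zv.1, bnd zv.1 = 0,
       on (induced (link K [set r]) W) e.+1 zv.2 & bnd zv.2 = zv.1 - z r].
  rewrite in_setD1 => /andP [vr vV].
  have vW : v \notin W by rewrite (disjointFr dV).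
  have [zvon zv0 _] := zP v vV.
  have [b bon bE] := zh v r vV rV.
  have rvW : r \notin v |: W by rewrite in_setU1 eq_sym (negPf vr).
  have vrW : v \notin r |: W by rewrite in_setU1 (negPf vr).
  have c2 : #|[set r; v]| = 2 by rewrite cards2 eq_sym vr.
  have WE : W :|: [set r; v] = r |: (v |: W) by rewrite setUC setUA.
  have WE' : W :|: [set r; v] = v |: (r |: W) by rewrite WE setUCA.
  (* The chain [b] joins the cones over [z r] and [z v] to a cycle, which the hypothesis for
     [R = {r, v}] fills. *)
  have := ac [set r; v]; rewrite c2 addn2 /= WE => /(_ _ isT).
  case/(_ _ (cone r (z r) - cone v (z v) + b)).
  - by apply/subsetP => x; rewrite !inE => /orP [] /eqP ->.
  - apply: onD; last by apply: on_inducedS bon; rewrite -WE subsetUl.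
    apply: onB; first by apply: on_inducedS (on_cone rW zron); apply/setUS/subsetUr.
    by apply: on_inducedS (on_cone vW zvon); rewrite -WE WE'; apply/setUS/subsetUr.
  - by rewrite !bndD bndN !bnd_cone zr0 zv0 !cone0 !subr0 bE addrC addrA subrK subrr.
  move=> c con cE.
  pose g := contr r c; pose h := contr v g.
  have gon : on (induced (link K [set r]) (v |: W)) e.+1 g by apply: on_contr.
  have gE : bnd g = - z r.
    apply: oppr_inj; rewrite -contr_bnd cE !contrD contrN opprK.
    rewrite contr_cone; last exact: on_notin zron.
    rewrite (contr_eq0 (c := cone v _)); last exact: on_notin (on_cone vW zvon).
    by rewrite (contr_eq0 (c := b)) ?subr0 ?addr0 //; apply: on_notin bon.
  have hE : bnd h = 0.
    apply: oppr_inj; rewrite -contr_bnd gE contrN oppr0 (contr_eq0 (c := z r)) ?oppr0 //.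
    exact: on_notin zron.
  exists (- h, g - cone v h); split=> /=.
  - exact/onN/on_contr.
  - by rewrite bndN hE oppr0.
  - exact: on_rest.
  - by rewrite bndD bndN gE bnd_cone hE cone0 subr0 addrC.
pose good v (zv : chain * chain) :=
    [/\ on (induced (link (link K [set r]) [set v]) W) e zv.1, bnd zv.1 = 0,
       on (induced (link K [set r]) W) e.+1 zv.2 & bnd zv.2 = zv.1 - z r].
have step' v : exists zv, v \in V :\ r -> good v zv.
  by case: (boolP (v \in V :\ r)) => [/step [zv ?]|_]; [exists zv | exists (0, 0)].
have [z' z'P] := @fin_all_exists T (fun=> (chain * chain)%type)
  (fun v zv => v \in V :\ r -> good v zv) step'.
have cK' := link_complex (F := [set r]) cK.
have : V :\ r \in link K [set r].
  have cV' : (#|V :\ r| < N)%N by move: cV; rewrite (cardsD1 r V) rV.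
  apply: (IH (V :\ r) cV' (link K [set r]) (fun v => (z' v).1)) => //.
  - exact: disjointWl (subsetDl _ _) dV.
  (* For the link of [r], [acyclic_link] uses the hypothesis at both [r |: R] and [R]. *)
  - move=> R RV R1; have rR : r \notin R by apply: contraL rV => /(subsetP RV); rewrite !inE eqxx.
    have RV' : R \subset V by apply: subset_trans RV (subsetDl _ _).
    apply: acyclic_link => //; first by rewrite in_setU negb_or rW.
    + have rRV : r |: R \subset V by rewrite subUset sub1set rV.
      have R2 : (1 < #|r |: R|)%N by rewrite cardsU1 rR add1n ltnS ltnW.
      have := ac _ rRV R2; rewrite cardsU1 rR add1n addnS /= setUCA.
      by rewrite prednK // addn_gt0 (ltnW R1) orbT.
    + exact: ac.
  - move=> v vV; have [on1 b1 on2 b2] := z'P v vV; split=> // c con cE.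
    (* A filling of the new class, corrected by the homology to [z r], would fill [z r]. *)
    apply: (zrn (c - (z' v).2)); first by apply: onB => //; apply: on_link_induced con.
    by rewrite bndD bndN cE b2 opprB addrC subrK.
  - move=> u v uV vV; have [_ _ on2 b2] := z'P u uV; have [_ _ on2' b2'] := z'P v vV.
    exists ((z' u).2 - (z' v).2); first exact: onB.
    by rewrite bndD bndN b2 b2' opprB addrA subrK.
by case/link1P => _; rewrite setD1K.
Qed.

(** * Matrix homology in terms of chains *)

Lemma homology_nonzeroPn K j U : simplicial_complex K ->
  reflect (acyclic K j.+1 U) (~~ homology_nonzero k (induced K U) j).
Proof.
move=> cK; set D := induced K U.
(* Chains on the faces of size [m] correspond to row vectors and [bnd] to right multiplication by
   [bd], so cycles form the kernel and boundaries the row space. *)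
pose row_of m (c : chain) : 'rV[k]_#|faces_sz D m| := \row_a c (enum_val a).
pose of_row m (x : 'rV[k]_#|faces_sz D m|) : chain :=
  [ffun A : {set T} => \sum_(a | enum_val a == A) x 0 a].
have of_rowK m x : row_of m (of_row m x) = x.
  apply/rowP => a; rewrite mxE ffunE (big_pred1 a) // => b.
  by rewrite /= (inj_eq enum_val_inj).
have on_of_row m x : on D m (of_row m x).
  move=> A; rewrite ffunE; case: (pickP [pred a | @enum_val _ (mem (faces_sz D m)) a == A]) => [a /= /eqP <- _|h].
    by have := enum_valP a; rewrite inE => /andP [? /eqP].
  by rewrite big_pred0 ?eqxx.
have row_of_inj m c c' : on D m c -> on D m c' -> row_of m c = row_of m c' -> c = c'.
  move=> con con' E; apply/ffunP => A.
  have [AD|AD] := boolP (A \in faces_sz D m).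
    by move/rowP/(_ (enum_rank_in AD A)): E; rewrite !mxE enum_rankK_in.
  have z c0 : on D m c0 -> c0 A = 0.
    move=> h; apply/eqP; apply: contraNT AD => /h [AD cA].
    by rewrite inE AD cA eqxx.
  by rewrite !z.
have row_bnd m c : on D m.+1 c -> row_of m.+1 c *m bd k D m = row_of m (bnd c).
  move=> con; apply/rowP => b; rewrite !mxE ffunE; set H := enum_val b.
  pose X A := \sum_(v | (v \in A) && (H == A :\ v)) pos_sign v A.
  transitivity (\sum_(A in faces_sz D m.+1) c A * X A).
    by rewrite [RHS]big_enum_val; apply: eq_bigr => a _; rewrite !mxE.
  have c0 A : A \notin faces_sz D m.+1 -> c A = 0.
    move=> nA; apply/eqP; apply: contraNT nA => /con [AD cA].
    by rewrite inE AD cA eqxx.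
  (* The sum is extended to all sets so that, after exchanging it with the sum over [v], only
     [A = v |: H] survives. *)
  transitivity (\sum_(A : {set T}) \sum_(v | (v \in A) && (H == A :\ v)) pos_sign v A * c A).
    rewrite big_mkcond; apply: eq_bigr => A _; case: ifPn => [_|/c0 ->].
      by rewrite /X big_distrr; apply: eq_bigr => v _; rewrite mulrC.
    by rewrite big1 // => v _; rewrite mulr0.
  rewrite (exchange_big_dep xpredT) //= [RHS]big_mkcond; apply: eq_bigr => v _.
  case: ifPn => vH.
    rewrite (big_pred1 (v |: H)) => [|A].
      by rewrite pos_signU // ltnn mul1r.
    apply/andP/eqP => [[vA /eqP ->]|->]; first by rewrite setD1K.
    by rewrite setU11 setU1K.
  by rewrite big_pred0 // => A; apply/andP => -[_ /eqP HE]; rewrite HE setD11 in vH.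
have row0 m : row_of m 0 = 0 by apply/rowP => a; rewrite !mxE ffunE.
have on0 m : on D m 0 by move=> A; rewrite ffunE eqxx.
have onb m c : on D m.+1 c -> on D m (bnd c).
  move=> con A; rewrite ffunE => nz.
  have [v] : exists v, (v \notin A) && (c (v |: A) != 0).
    apply/existsP; apply: contraNT nz => /existsPn h; apply/eqP; rewrite big1 // => v vA.
    by have := h v; rewrite vA /= => /negPn/eqP ->; rewrite mulr0.
  case/andP => vA /con [/inducedP [AK sA] cA]; split; last by move: cA; rewrite cardsU1 vA => -[].
  apply/inducedP; split; first exact: cK AK (subsetUr _ _).
  exact: subset_trans (subsetUr _ _) sA.
apply: (iffP idP) => [/negPn/submxP [X XE] z zon z0|ac].
  have /sub_kermxP : row_of j.+1 z *m bd k D j = 0 by rewrite row_bnd // z0 row0.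
  case/submxP => Y YE; exists (of_row _ (Y *m X)) => //.
  apply: (row_of_inj j.+1) => //; first exact: onb.
  by rewrite -row_bnd // of_rowK YE XE mulmxA.
apply/negPn/row_subP => i; set x := row i _.
have [||c con cE] := ac (of_row _ x) => //.
  apply: (row_of_inj j) => //; first exact: onb.
  by rewrite -row_bnd // of_rowK row0; apply/sub_kermxP; apply: row_sub.
by rewrite -[x]of_rowK -cE -row_bnd // submxMl.
Qed.

End Chains.

(** * Counting *)

Lemma sum_le_max_term (I : finType) (P : pred I) (a : I -> nat) :
  0 < \sum_(i | P i) a i ->
  exists2 i, P i & \sum_(i | P i) a i <= #|P| * a i.
Proof.
move=> s0; have P0 : 0 < #|P|.
  rewrite lt0n; apply: contraTneq s0 => P0; rewrite big_pred0 // => i.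
  by have := card0_eq P0 i.
have [i Pi mE] := eq_bigmax_cond a P0.
exists i => //; rewrite -mE -sum_nat_const; apply: leq_sum => j Pj.
exact: leq_bigmax_cond.
Qed.

Lemma pigeonhole_fiber (A B : finType) (X : {set A}) (Y : {set B}) (f : A -> B) :
  0 < #|X| -> (forall x, x \in X -> f x \in Y) ->
  exists2 y, y \in Y & #|X| <= #|Y| * #|[set x in X | f x == y]|.
Proof.
move=> X0 fY.
have E : #|X| = \sum_(y in Y) #|[set x in X | f x == y]|.
  rewrite -sum1_card (partition_big f (mem Y)) //=; apply: eq_bigr => y _.
  by rewrite -sum1_card; apply: eq_bigl => x; rewrite inE.
by rewrite E in X0 *; have [y yY h] := sum_le_max_term X0; exists y.
Qed.

(** This is [(b - a) * (b ^ r - a ^ r) >= 0] expanded without subtraction. *)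
Lemma chebyshev_pow (a b r : nat) :
  a * b ^ r + b * a ^ r <= a ^ r.+1 + b ^ r.+1.
Proof.
wlog ab : a b / a <= b.
  move=> h; case: (leqP a b) => [/h //|/ltnW /h].
  by rewrite addnC [X in _ <= X]addnC.
have abr : a ^ r <= b ^ r by case: r => // r; rewrite leq_exp2r.
by rewrite !expnS; nia.
Qed.

(** Induction on [r] by Chebyshev's sum inequality, which is proved by summing [chebyshev_pow] over
    all pairs of indices. *)
Lemma power_mean (I : finType) (P : pred I) (a : I -> nat) (r : nat) :
  (\sum_(i | P i) a i) ^ r.+1 <= #|P| ^ r * \sum_(i | P i) a i ^ r.+1.
Proof.
elim: r => [|r IH]; first by rewrite expn0 mul1n expn1; apply: leq_sum.
set s := \sum_(i | P i) a i.
have cheb : s * \sum_(i | P i) a i ^ r.+1 <= #|P| * \sum_(i | P i) a i ^ r.+2.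
  rewrite -(leq_pmul2l (isT : 0 < 2)).
  have -> : 2 * (s * \sum_(i | P i) a i ^ r.+1)
     = \sum_(i | P i) \sum_(j | P j) (a i * a j ^ r.+1 + a j * a i ^ r.+1).
    rewrite mul2n -addnn.
    have E : s * \sum_(i | P i) a i ^ r.+1 = \sum_(i | P i) \sum_(j | P j) a i * a j ^ r.+1.
      by rewrite big_distrl; apply: eq_bigr => i _; rewrite big_distrr.
    rewrite E [X in _ + X]exchange_big -big_split; apply: eq_bigr => i _.
    by rewrite -big_split.
  apply: (@leq_trans (\sum_(i | P i) \sum_(j | P j) (a i ^ r.+2 + a j ^ r.+2))).
    by apply: leq_sum => i _; apply: leq_sum => j _; apply: chebyshev_pow.
  rewrite (eq_bigr (fun i => #|P| * a i ^ r.+2 + \sum_(j | P j) a j ^ r.+2)); last first.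
    by move=> i _; rewrite big_split sum_nat_const.
  rewrite big_split -big_distrr sum_nat_const /= mul2n -addnn; exact: leqnn.
rewrite expnS; apply: leq_trans (leq_mul (leqnn s) IH) _.
by rewrite mulnCA expnS -mulnA [#|P| * _]mulnCA leq_mul2l cheb orbT.
Qed.

Lemma leq_bin_exp (n m : nat) : 'C(n, m) <= n ^ m.
Proof.
apply: leq_trans (_ : n ^_ m <= _); first by rewrite -bin_ffact leq_pmulr ?fact_gt0.
elim: m n => [|m IH] n //; rewrite ffactnS expnS leq_mul //.
by apply: leq_trans (IH _) _; case: m {IH} => // m; rewrite leq_exp2r // leq_pred.
Qed.

(** The condition makes each factor [n - i] of the falling factorial at least [n / 2]. *)
Lemma exp_leq_bin (n m : nat) : 2 * m <= n.+1 -> n ^ m <= 2 ^ m * m`! * 'C(n, m).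
Proof.
move=> mn; rewrite -mulnA [m`! * _]mulnC bin_ffact.
have -> : n ^_ m = \prod_(i < m) (n - i) by apply: ffact_prod.
rewrite -[X in 2 ^ X]card_ord -[X in n ^ X]card_ord -!prod_nat_const -big_split /=.
by apply: leq_prod => i _; have := ltn_ord i; lia.
Qed.

Section Supersaturation.
Variables (T : finType) (L : {set T}) (Rs : {set {set T}}) (d : nat).
Hypothesis RsP : forall R, R \in Rs -> R \subset L /\ 1 < #|R|.
Hypothesis hit : forall A : {set T}, A \subset L -> #|A| = d.+1 -> exists2 R, R \in Rs & R \subset A.

(** Pairs [R \subset A] with [#|A| = d.+1] are counted twice: every [A] occurs, while an [R] of size
    [r] lies in at most [#|L| ^ (d.+1 - r)] of the [A]. One of the at most [d.+2] sizes carries its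
    share. *)
Lemma supersaturation : 2 * d < #|L| ->
  exists r, 1 < r /\ #|L| ^ r <=
    d.+2 * (2 ^ d.+1 * d.+1`!) * #|[set R in Rs | #|R| == r]|.
Proof.
move=> dL; set D := #|L|; set t := d.+1.
pose X := [set A : {set T} | (A \subset L) && (#|A| == t)].
have cX : #|X| = 'C(D, t) by apply: cards_draws.
have tD : t <= D by rewrite /t /D; lia.
have X0 : 0 < #|X| by rewrite cX bin_gt0.
have ext (R : {set T}) : R \subset L -> #|R| <= t ->
    #|[set A in X | R \subset A]| <= D ^ (t - #|R|).
  move=> RL Rt; apply: leq_trans (leq_bin_exp _ _).
  rewrite -cards_draws -(card_in_imset (f := fun A : {set T} => A :\: R)).
    apply/subset_leq_card/subsetP => _ /imsetP [A + ->].
    rewrite !inE => /andP [/andP [AL /eqP At] RA].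
    by rewrite (subset_trans (subsetDl _ _) AL) cardsD (setIidPr RA) At /=.
  move=> A B; rewrite !inE => /andP [_ RA] /andP [_ RB] E.
  by rewrite -(setID A R) -(setID B R) E (setIidPr RA) (setIidPr RB).
have le1 : #|X| <= \sum_(r : 'I_t.+1 | 1 < r) #|[set R in Rs | #|R| == r]| * D ^ (t - r).
  pose Q := [pred R : {set T} | (R \in Rs) && (#|R| <= t)].
  apply: (@leq_trans (\sum_(A in X) \sum_(R | Q R) (R \subset A))).
    rewrite -sum1_card; apply: leq_sum => A; rewrite inE => /andP [AL /eqP At].
    have [R RR RA] := hit AL At; rewrite (bigD1 R) /= ?RA //.
    by rewrite RR -At subset_leq_card.
  rewrite exchange_big /=.
  rewrite (partition_big (fun R : {set T} => inord #|R| : 'I_t.+1) (fun r => 1 < r)) /=; last first.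
    by move=> R /andP [/RsP [_ R1] Rt]; rewrite inordK.
  apply: leq_sum => r r1; rewrite -sum_nat_const.
  rewrite [X in _ <= X](eq_bigl (fun R => Q R && (inord #|R| == r))); last first.
    move=> R; rewrite inE -andbA; case: (R \in Rs) => //=.
    apply/eqP/andP => [Rr|[Rt /eqP <-]]; last by rewrite inordK.
    by rewrite Rr -ltnS ltn_ord inord_val.
  apply: leq_sum => R /andP [/andP [RR Rt] /eqP <-].
  rewrite inordK // -big_mkcondr sum1dep_card.
  by apply: leq_trans (ext _ (RsP RR).1 Rt); rewrite eq_leq //; apply: eq_card => A; rewrite !inE.
have [r r1 le2] := sum_le_max_term (leq_trans X0 le1).
exists r; split=> //; set N := #|[set R in Rs | _]| in le2 *.
have D0 : 0 < D by apply: leq_trans tD.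
rewrite -(leq_pmul2r (_ : 0 < D ^ (t - r))) ?expn_gt0 ?D0 // -expnD subnKC; last by rewrite -ltnS.
have tD2 : 2 * t <= D.+1 by rewrite /t /D; lia.
apply: leq_trans (exp_leq_bin tD2) _; rewrite -cX.
move: (2 ^ t * _) => M; rewrite [d.+2 * _]mulnC -!mulnA leq_mul2l; apply/orP; right.
apply: leq_trans (leq_trans le1 le2) _; rewrite leq_mul2r; apply/orP; right.
by apply: leq_trans (max_card _) _; rewrite card_ord.
Qed.
End Supersaturation.

(** * Arithmetic of the exponents *)

Lemma exponent_balance (q r : nat) : 1 < r -> r <= q ->
  q.+1 * r.-1 + (q - r).+1 = r * q.
Proof.
case: r => // r _ /subnK <-; rewrite addnK /=; move: (q - r.+1) => x; nia.
Qed.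
(** The summands on the right are the costs in [descend] of the sets of size [q - 1], of the choice
    of [R], and of the choice of [F0]. *)
Lemma exponent_split (q r : nat) : 0 < q -> 1 < r ->
  q.+1 * r.-1 = q.-1 * r.-1 + (r + (r - 2)).
Proof.
case: q => // q _; case: r => [|[|r]] //= _; rewrite !mulSn; lia.
Qed.

(** Raising the bound for [h'] to the power [s = 2 ^ r.-1] turns its saving of 1 in the exponent of
    [n] into a saving of [s]. As [r <= s], a saving of [r] remains, which the final [r]-th root
    turns back into 1. *)
Lemma exponent_step (n q r h h' c c' : nat) : 0 < n -> 1 < r -> r <= q -> 0 < c' ->
  h ^ r <= c * n ^ (q.+1 * r.-1) * h' ->
  h' ^ (2 ^ (q - r)) <= c' * n ^ ((q - r).+1 * 2 ^ (q - r)).-1 ->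
  h ^ (2 ^ q.-1) <= (c * c').+1 ^ (2 ^ q.-1) * n ^ (q * 2 ^ q.-1).-1.
Proof.
move=> n0 r1 rq c'0 H1 H2.
have eE : 2 ^ q.-1 = 2 ^ (q - r) * 2 ^ r.-1 by rewrite -expnD; congr (_ ^ _); lia.
set e := 2 ^ q.-1 in eE *; set e' := 2 ^ (q - r) in eE H2; set s := 2 ^ r.-1 in eE.
have e'0 : 0 < e' by rewrite expn_gt0.
have rs : r <= s by rewrite /s -{1}(ltn_predK r1); apply: ltn_expl.
have h'e : h' ^ e <= c' ^ s * n ^ ((q - r).+1 * e - s).
  rewrite eE expnM; apply: leq_trans (_ : (c' * n ^ ((q - r).+1 * e').-1) ^ s <= _).
    by rewrite leq_exp2r // expn_gt0.
  by rewrite expnMn -expnM -subn1 mulnBl mul1n -mulnA -eE.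
have e0 : 0 < e by rewrite expn_gt0.
have s0 : 0 < s by rewrite expn_gt0.
have he : (h ^ e) ^ r <= (c * c').+1 ^ e * n ^ (r * q * e - r).
  rewrite -expnM mulnC expnM.
  apply: leq_trans (_ : (c * n ^ (q.+1 * r.-1) * h') ^ e <= _); first by rewrite leq_exp2r.
  rewrite !expnMn -mulnA.
  apply: leq_trans (_ : c ^ e * c' ^ e * n ^ (r * q * e - s) <= _).
    rewrite -mulnA leq_mul2l; apply/orP; right.
    apply: leq_trans (leq_mul (leqnn _) h'e) _.
    rewrite mulnCA; apply: leq_mul; first by rewrite leq_pexp2l // eE leq_pmull.
    rewrite -expnM -expnD eq_leq //; congr (_ ^ _).
    have := leq_pmull s e'0; rewrite -eE => se.
    rewrite addnBA; last by rewrite (leq_trans se) // leq_pmull.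
    by rewrite -mulnDl exponent_balance.
  rewrite -expnMn leq_mul ?leq_exp2r // leq_pexp2l //; exact: leq_sub2l.
have r0 : 0 < r by apply: ltnW.
rewrite -(leq_exp2r _ _ r0); apply: leq_trans he _.
rewrite expnMn leq_mul //.
  rewrite -[X in X <= _]expn1 leq_pexp2l ?expn_gt0 //.
rewrite -expnM leq_pexp2l //.
by rewrite -subn1 mulnBl mul1n -mulnA [(q * e) * r]mulnC leqnn.
Qed.

(** * Links and girth *)

Section Links.
Variables (k : fieldType) (T : finType).
Implicit Types (A F R S U W : {set T}) (G : {set {set T}}).

Lemma disjoint_setUl A F R : [disjoint A :|: F & R] = [disjoint A & R] && [disjoint F & R].
Proof. by rewrite !disjoints_subset subUset. Qed.

Lemma disjoint_setUr A F R : [disjoint A & F :|: R] = [disjoint A & F] && [disjoint A & R].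
Proof. by rewrite disjoint_sym disjoint_setUl ![[disjoint _ & A]]disjoint_sym. Qed.

Lemma link_link G F F' : [disjoint F & F'] -> link (link G F) F' = link G (F :|: F').
Proof.
move=> dF; apply/setP => A; apply/linkP/linkP => [[d1 /linkP [d2 h]]|[d h]].
  move: d2; rewrite disjoint_setUl => /andP [d2 _].
  by rewrite disjoint_setUr d1 d2 [F :|: _]setUC setUA.
move: d; rewrite disjoint_setUr => /andP [d1 d2]; split=> //; apply/linkP.
by rewrite disjoint_setUl d1 disjoint_sym dF -setUA [F' :|: F]setUC.
Qed.

Lemma acyclic_empty G m U : (forall A, A \notin G) -> acyclic k G m U.
Proof.
move=> h z zon _; exists 0%R; first by move=> A; rewrite ffunE eqxx.
rewrite bnd0; apply/ffunP => A; rewrite ffunE; apply/esym/eqP; apply/negPn/negP => /zon.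
by case=> /inducedP []; rewrite (negPf (h A)).
Qed.

Lemma link_notin G F A : simplicial_complex G -> F \notin G -> A \notin link G F.
Proof. by move=> cG; apply: contra => /linkP [_ h]; apply: cG h (subsetUr _ _). Qed.

Definition links_acyclic G p := forall i F U, #|U| <= 2 * p + i ->
  acyclic k (link G F) (p + i) U.

Lemma links_acyclic_link G F p : simplicial_complex G ->
  links_acyclic G p -> links_acyclic (link G F) p.
Proof.
move=> cG h i F' U cU; have [d|nd] := boolP [disjoint F & F'].
  by rewrite link_link //; apply: h.
apply: acyclic_empty => A; apply: contra nd => /linkP [_ /linkP [+ _]].
by rewrite disjoint_setUl disjoint_sym => /andP [_]; rewrite disjoint_sym.
Qed.

Lemma girth_gt_le G j m W : girth_gt k G j m -> girth_witness k G j W -> m < #|W|.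
Proof.
rewrite /girth_gt /girth; case: existsP => [_|h] + w; last by case: h; exists W.
have : W \in index_enum {set T} by apply: mem_index_enum.
elim: (index_enum _) => // V r IH; rewrite inE big_cons => /predU1P [<-|/IH Wr].
  by rewrite w leq_min => /andP [].
by case: ifP => _ //; rewrite leq_min => /andP [_].
Qed.

(** Induction on [i]: by [acyclic_of_links], acyclicity one dimension up follows from that of the
    links of vertices, on one vertex fewer. *)
Lemma girth_links_acyclic G p : simplicial_complex G ->
  girth_gt k G p (2 * p.+1) -> links_acyclic G p.+1.
Proof.
move=> cG gG; elim => [|i IH] F U cU.
  rewrite !addn0 in cU *; apply/homology_nonzeroPn; first exact: link_complex.
  have [FG|/link_notin h] := boolP (F \in G); last first.
    apply/homology_nonzeroPn; first exact: link_complex.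
    by apply: acyclic_empty => A; apply: h.
  apply/negP => nz; have := @girth_gt_le G p (2 * p.+1) U gG.
  rewrite ltnNge cU => /(_ _)/notF; apply; apply/existsP; exists F; by rewrite FG.
rewrite addnS; apply: (@acyclic_of_links _ _ _ _ (2 * p.+1 + i)) => //; last by rewrite -addnS.
  exact: link_complex.
move=> v U' vU' cU'; have [vF|vF] := boolP (v \in F); last first.
  by rewrite link_link ?(disjoint_sym F) ?disjoints1 //; apply: IH.
apply: acyclic_empty => A; apply/negP => /linkP [_ /linkP []].
by rewrite disjoint_setUl disjoints1 vF andbF.
Qed.

Lemma not_acyclicP G m U : ~ acyclic k G m U ->
  exists z : {ffun {set T} -> k}, [/\ on (induced G U) m z, bnd z = 0%R &
    forall c, on (induced G U) m.+1 c -> bnd c <> z].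
Proof.
move=> h; apply: NNPP => n; apply: h => z zon z0; apply: NNPP => nb.
by apply: n; exists z; split=> // c con cE; apply: nb; exists c.
Qed.

(** Otherwise [mem_of_acyclic] in the link of [S], with the constant family [z], makes [A] a face of
    more than [d] vertices. The family may be constant because all the links restrict to the same
    [D]. *)
Lemma exists_nonzero_subset G (d : nat) S W A e (D : {set {set T}}) (z : {ffun {set T} -> k}) :
  simplicial_complex G -> (forall F, F \in G -> #|F| <= d) -> d < #|A| ->
  (forall v, v \in A -> [/\ v \notin S, [disjoint v |: S & W] &
     induced (link G (v |: S)) W = D]) ->
  on D e z -> bnd z = 0%R -> (forall c, on D e.+1 c -> bnd c <> z) ->
  exists R, [/\ R \subset A, 1 < #|R| &
    homology_nonzero k (induced (link G S) (W :|: R)) (e + #|R|).-2].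
Proof.
move=> cG dG dA AP zon z0 zn.
have [/existsP [R /and3P [h1 h2 h3]]|/existsPn h] := boolP [exists R : {set T},
   [&& R \subset A, 1 < #|R| & homology_nonzero k (induced (link G S) (W :|: R)) (e + #|R|).-2]].
  by exists R.
have cL := link_complex (F := S) cG.
have lE v : v \in A -> induced (link (link G S) [set v]) W = D.
  move=> /AP [vS _ <-]; rewrite link_link 1?setUC //.
  by rewrite disjoint_sym disjoints1.
suff /linkP [_ /dG] : A \in link G S.
  by rewrite leqNgt (leq_trans dA) // subset_leq_card // subsetUl.
apply: (@mem_of_acyclic k _ _ W A e (fun=> z)) => //.
- by rewrite -card_gt0; apply: leq_ltn_trans dA.
- rewrite -setI_eq0; apply/eqP/setP => v; rewrite !inE; apply/negP => /andP [vA vW].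
  by have [_ /disjointFl/(_ vW)] := AP v vA; rewrite setU11.
- move=> R RA R1; have := h R; rewrite RA R1 /= => nz.
  have -> : (e + #|R|).-1 = (e + #|R|).-2.+1 by lia.
  exact/homology_nonzeroPn.
- by move=> v vA; rewrite lE.
- move=> u v _ _; exists 0%R; last by rewrite bnd0 GRing.subrr.
  by move=> B; rewrite ffunE eqxx.
Qed.

End Links.

(** * The inductive step *)

(** [D] and [z] are shared by all [S] in [H], so classes at different vertices are the same chain
    and trivially homologous. The face [F] of a stage is absorbed into [G], which is then a link. *)
Definition common_class (k : fieldType) (T : finType) (G : {set {set T}})
  (W : {set T}) (e q : nat) (H : {set {set T}}) :=
  exists (D : {set {set T}}) (z : {ffun {set T} -> k}),
  [/\ on D e z, bnd z = 0%R, (forall c, on D e.+1 c -> bnd c <> z) &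
   forall S, S \in H -> [/\ #|S| = q, [disjoint S & W] & induced (link G S) W = D]].

Definition supersat_const d := d.+2 * (2 ^ d.+1 * d.+1`!).
(** The first factor pays for discarding poor sets and fixing [r]; the double exponential bounds the
    number of families of subsets of [W :|: R]. *)
Definition step_const p d := (2 * p.+1) ^ p * (supersat_const d * 2 ^ (2 ^ (2 * p))).

Section Step.
Variables (k : fieldType) (T : finType) (G : {set {set T}}) (p d q e : nat)
  (W : {set T}) (H : {set {set T}}).
Hypotheses (cG : simplicial_complex G) (dG : forall F, F \in G -> #|F| <= d)
  (gG : links_acyclic k G p) (q0 : 0 < q) (eq_p : e + q = p) (cW : #|W| <= 2 * e)
  (HP : common_class k G W e q H) (Hbig : 4 * d * #|T| ^ q.-1 < #|H|).

Let P := [set S : {set T} | #|S| == q.-1].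
Let ext (S : {set T}) := [set v | (v \notin S) && (v |: S \in H)].
Let Rs (S : {set T}) := [set R : {set T} | [&& R \subset ext S, 1 < #|R| &
  homology_nonzero k (induced (link G S) (W :|: R)) (e + #|R|).-2]].

Let n := #|T|.

Let cP : #|P| <= n ^ q.-1.
Proof. by rewrite card_draws leq_bin_exp. Qed.

(** A larger [R] would carry homology in dimension at least [p - 1] on so few vertices that [gG]
    excludes it. *)
Let card_Rs S R : R \in Rs S -> #|R| <= q.
Proof.
rewrite inE => /and3P [RS R1 nz]; rewrite leqNgt; apply/negP => qR.
have cU : #|W :|: R| <= 2 * p + (#|R| - q.+1).
  by have := (leq_card_setU W R).1; lia.
have ac := gG (F := S) cU; have E : p + (#|R| - q.+1) = (e + #|R|).-2.+1 by lia.
by rewrite E in ac; move/(homology_nonzeroPn _ _ _ (link_complex cG))/negP: ac; apply.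
Qed.

Let sum_ext : #|H| <= \sum_(S in P) #|ext S|.
Proof.
have [D [z [_ _ _ HS]]] := HP.
rewrite (eq_bigr (fun S => \sum_(v | v \in ext S) 1)) => [|S _]; last by rewrite sum1_card.
rewrite pair_big_dep sum1_card /=.
pose f (x : {set T} * T) := x.2 |: x.1.
apply: leq_trans (leq_imset_card f _); apply/subset_leq_card/subsetP => S SH.
have [cS _ _] := HS S SH.
have [v vS] : exists v, v \in S by apply/set0Pn; rewrite -card_gt0 cS.
apply/imsetP; exists (S :\ v, v); last by rewrite /f /= setD1K.
rewrite unfold_in /= !inE eqxx /= setD1K // SH !andbT.
by move: cS; rewrite (cardsD1 v) vS => <-.
Qed.

(** The sets [S] for which size [r] is a possible outcome of [supersaturation]. *)
Let Xr r := [set S in P | #|ext S| ^ r <= supersat_const d * #|[set R in Rs S | #|R| == r]|].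

Let rich S : S \in P -> 2 * d < #|ext S| -> exists r : 'I_q.+1, 1 < r /\ S \in Xr r.
Proof.
move=> SP dS; have [D [z [zon z0 zn HS]]] := HP.
have [||r [r1 h]] := @supersaturation _ (ext S) (Rs S) d _ _ dS.
- by move=> R; rewrite inE => /and3P [].
- move=> A AS cA.
  have [//|//|||//|//|//|R [RA R1 nz]] := @exists_nonzero_subset k T G d S W A e D z.
  + by rewrite cA.
  + move=> v /(subsetP AS); rewrite inE => /andP [vS /HS [_ dv lv]]; by split.
  by exists R => //; rewrite inE (subset_trans RA AS) R1 nz.
have ext0 : 0 < #|ext S| by apply: leq_ltn_trans dS.
have rq : r < q.+1.
  have : 0 < #|[set R in Rs S | #|R| == r]|.
    rewrite lt0n; apply: contraTneq h => ->; rewrite muln0 -ltnNge expn_gt0 ext0 //.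
  by case/card_gt0P => R; rewrite inE => /andP [/card_Rs h1 /eqP <-].
by exists (Ordinal rq); rewrite inE SP.
Qed.

(** Sets with at most [2 * d] extensions account for less than half of [H] by [Hbig]; the rest is
    shared among at most [q.+1] values of [r]. *)
Let exists_rich : exists r : 'I_q.+1, 1 < r /\
  0 < \sum_(S in Xr r) #|ext S| /\ #|H| <= 2 * q.+1 * \sum_(S in Xr r) #|ext S|.
Proof.
have le1 : #|H| <= 2 * d * n ^ q.-1 + \sum_(r : 'I_q.+1 | 1 < r) \sum_(S in Xr r) #|ext S|.
  apply: leq_trans sum_ext _.
  apply: (@leq_trans (\sum_(S in P) (2 * d + \sum_(r : 'I_q.+1 | (1 < r) && (S \in Xr r)) #|ext S|))).
    apply: leq_sum => S SP; case: (leqP #|ext S| (2 * d)) => [h|/(rich SP) [r [r1 Sr]]].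
      exact: leq_trans h (leq_addr _ _).
    by rewrite (bigD1 r) /= ?r1 // addnCA leq_addr.
  rewrite big_split /= sum_nat_const leq_add //; first by rewrite mulnC leq_mul.
  rewrite (exchange_big_dep (fun r : 'I_q.+1 => 1 < r)) /= => [|S r _ /andP [] //].
  apply: leq_sum => r r1; rewrite eq_leq //; apply: eq_bigl => S.
  by rewrite r1 /= andb_idl // inE => /andP [].
set s := \sum_(r : 'I_q.+1 | _) _ in le1.
have s2 : #|H| <= 2 * s.
  by move: Hbig le1; rewrite -/n -!mulnA; move: (d * _) => M; lia.
have s0 : 0 < s by move: Hbig s2; case: (s) => //; lia.
have [r r1 h] := sum_le_max_term s0; exists r; split=> //; split.
  by move: (leq_trans s0 h); rewrite muln_gt0 => /andP [].
apply: leq_trans s2 _; rewrite -mulnA leq_mul2l /=; apply: leq_trans h _.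
rewrite leq_mul2r; apply/orP; right; apply: leq_trans (max_card _) _.
by rewrite card_ord.
Qed.

Lemma descend : exists r R F0 H',
  [/\ 1 < r, r <= q, #|W :|: R| <= 2 * (e + r.-1) &
   common_class k (link G F0) (W :|: R) (e + r.-1) (q - r).+1 H' /\
   #|H| ^ r <= step_const p d * n ^ (q.+1 * r.-1) * #|H'|].
Proof.
have [r [r1 [s0 hs]]] := exists_rich; set s := \sum_(S in Xr r) _ in s0 hs.
have rq : r <= q by rewrite -ltnS.
have n0 : 0 < n.
  have [D [z [_ _ _ HS]]] := HP.
  have : 0 < #|H| by apply: leq_ltn_trans Hbig.
  case/card_gt0P => S /HS [cS _ _]; have : S != set0 by rewrite -card_gt0 cS.
  by case/set0Pn => v _; apply/card_gt0P; exists v.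
pose N (R : {set T}) := #|[set S in P | R \in Rs S]|.
(* The power mean turns the sum of the [#|ext S|] into a count of pairs [(S, R)], and one of the at
   most [n ^ r] sets [R] gets its share. *)
have [R cR hR] : exists2 R : {set T}, #|R| = r &
    s ^ r <= n ^ (q.-1 * r.-1) * supersat_const d * (n ^ r * N R).
  have pm := power_mean (mem (Xr r)) (fun S => #|ext S|) r.-1.
  rewrite prednK ?(ltnW r1) // in pm.
  have cX : #|Xr r| ^ r.-1 <= n ^ (q.-1 * r.-1).
    rewrite expnM leq_exp2r; last by lia.
    by apply: leq_trans cP; apply: subset_leq_card; apply/subsetP => S; rewrite inE => /andP [].
  have le2 : \sum_(S in Xr r) #|ext S| ^ r <=
      supersat_const d * \sum_(R : {set T} | #|R| == r) N R.
    apply: (@leq_trans (supersat_const d * \sum_(S in P) #|[set R in Rs S | #|R| == r]|)).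
      rewrite big_distrr /= [X in _ <= X](bigID (mem (Xr r))) /=.
      apply: leq_trans (leq_addr _ _).
      rewrite [X in _ <= X](eq_bigl (mem (Xr r))) => [|S]; last first.
        by rewrite /= andb_idl // inE => /andP [].
      by apply: leq_sum => S; rewrite inE => /andP [].
    rewrite leq_mul2l; apply/orP; right; rewrite eq_leq //.
    rewrite (eq_bigr (fun S => \sum_(R : {set T} | #|R| == r) (R \in Rs S))) => [|S _].
      rewrite exchange_big; apply: eq_bigr => R _.
      by rewrite -big_mkcondr sum1dep_card /N; apply: eq_card => S; rewrite !inE.
    by rewrite -big_mkcondr sum1dep_card; apply: eq_card => R; rewrite !inE andbC.
  have le3 := leq_trans pm (leq_mul cX le2); rewrite -/s in le3.
  have S0 : 0 < \sum_(R : {set T} | #|R| == r) N R.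
    have : 0 < s ^ r by rewrite expn_gt0 s0.
    by move=> /leq_trans/(_ le3); rewrite !muln_gt0 => /and3P [].
  have [R /eqP cR h] := sum_le_max_term S0; exists R => //.
  apply: leq_trans le3 _; rewrite -mulnA !leq_mul2l; apply/orP; right; apply/orP; right.
  apply: leq_trans h _; rewrite leq_mul2r; apply/orP; right.
  rewrite -cardsE card_draws; exact: leq_bin_exp.
(* Here [2 * e + r <= 2 * (e + r.-1)] because [r >= 2]. *)
have cWR : #|W :|: R| <= 2 * (e + r.-1).
  by have := (leq_card_setU W R).1; rewrite cR; lia.
pose X := [set S in P | R \in Rs S]; rewrite -[N R]/#|X| in hR.
have X0 : 0 < #|X|.
  have : 0 < s ^ r by rewrite expn_gt0 s0.
  move=> /leq_trans/(_ hR); rewrite muln_gt0 => /andP [_]; rewrite muln_gt0 => /andP [_ NR]; exact: NR.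
pose lk S := induced (link G S) (W :|: R).
have [|D' _ hD] := @pigeonhole_fiber _ _ X (powerset (powerset (W :|: R))) lk X0.
  by move=> S _; rewrite powersetE; apply/subsetP => A /inducedP [_]; rewrite powersetE.
set X1 := [set S in X | lk S == D'] in hD.
have X10 : 0 < #|X1| by move: (leq_trans X0 hD); rewrite muln_gt0 => /andP [].
(* The default [set0] is never taken on [X1], since [r - 2 <= q.-1 = #|S|]. *)
pose f (S : {set T}) := odflt set0 [pick F : {set T} | (F \subset S) && (#|F| == r - 2)].
have fP S : S \in X1 -> f S \subset S /\ #|f S| = r - 2.
  rewrite !inE => /andP [/andP [/eqP cS _] _]; rewrite /f.
  case: pickP => [F /andP [? /eqP] //|h].
  have : 0 < #|[set F : {set T} | (F \subset S) && (#|F| == r - 2)]|.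
    by rewrite cards_draws bin_gt0 cS; lia.
  by case/card_gt0P => F; rewrite inE h.
have [|F0 _ hF] := @pigeonhole_fiber _ _ X1 [set F : {set T} | #|F| == r - 2] f X10.
  by move=> S /fP [_ c]; rewrite inE c.
set X2 := [set S in X1 | f S == F0] in hF.
have X2P S : S \in X2 -> [/\ F0 \subset S, #|F0| = r - 2, #|S| = q.-1, R \in Rs S & lk S = D'].
  rewrite inE => /andP [SX /eqP <-]; have [-> ->] := fP S SX.
  by move: SX; rewrite inE => /andP [+ /eqP ->]; rewrite inE => /andP [+ ->]; rewrite inE => /eqP ->.
have X20 : 0 < #|X2| by move: (leq_trans X10 hF); rewrite muln_gt0 => /andP [].
(* The new sets have size [q.-1 - (r - 2) = (q - r).+1], so the two parameters of the stage still
   add up to [p]. *)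
exists r, R, F0, [set S :\: F0 | S in X2]; split=> //; split.
  have /card_gt0P [S0 S0X] := X20; have [_ _ _ RS0 lk0] := X2P S0 S0X.
  have := RS0; rewrite inE cR => /and3P [_ _ nz].
  have [|z [zon z0 zn]] := @not_acyclicP k T (link G S0) (e + r).-2.+1 (W :|: R).
    by move/(homology_nonzeroPn _ _ _ (link_complex cG))/negP; apply.
  have E : (e + r).-2.+1 = e + r.-1 by lia.
  rewrite E -/(lk S0) lk0 in zon zn.
  exists D', z; split=> // _ /imsetP [S SX ->]; have [F0S cF0 cS RS lkS] := X2P S SX.
  have FS : F0 :|: S :\: F0 = S by rewrite setDE setUIr setUCr setIT (setUidPr F0S).
  split.
    rewrite cardsD (setIidPr F0S) cS cF0; move: q0 r1 rq; clear; lia.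
    apply: disjointWl (subsetDl _ _) _; rewrite disjoint_setUr; apply/andP; split.
      (* Any [v] in [R] gives a member [v |: S] of [H], which is disjoint from [W]. *)
      have [D [z' [_ _ _ HS]]] := HP.
      have : R != set0 by rewrite -card_gt0 cR ltnW.
      case/set0Pn => v vR; move: RS; rewrite inE => /and3P [/subsetP/(_ v vR) + _ _].
      rewrite inE => /andP [_ /HS [_ + _]].
      by apply: disjointWl; apply: subsetUr.
    rewrite -setI_eq0; apply/eqP/setP => v; rewrite in_set0 in_setI; apply/negP => /andP [vS vR].
    by move: RS; rewrite inE => /and3P [/subsetP/(_ v vR) + _ _]; rewrite inE vS.
  rewrite link_link ?FS //.
  by rewrite -setI_eq0; apply/eqP/setP => v; rewrite !inE; case: (v \in F0).
rewrite card_in_imset; last first.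
  move=> S S' /X2P [h1 _ _ _ _] /X2P [h2 _ _ _ _] hE.
  by rewrite -(setID S F0) -(setID S' F0) hE (setIidPr h1) (setIidPr h2).
have hX : #|X| <= 2 ^ (2 ^ (2 * p)) * (n ^ (r - 2) * #|X2|).
  apply: leq_trans hD _; rewrite !card_powerset leq_mul //.
    by rewrite !leq_exp2l //; lia.
  apply: leq_trans hF _; rewrite leq_mul2r; apply/orP; right.
  by rewrite card_draws leq_bin_exp.
apply: (@leq_trans ((2 * q.+1) ^ r * s ^ r)).
  by rewrite -expnMn leq_exp2r ?(ltnW r1).
rewrite /step_const.
move: (supersat_const d) (2 ^ (2 ^ (2 * p))) hX hR => M M' hX hR; rewrite -!mulnA.
apply: leq_mul.
  apply: (@leq_trans ((2 * p.+1) ^ r)); first by rewrite leq_exp2r ?(ltnW r1) //; lia.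
  by rewrite leq_pexp2l //; lia.
apply: leq_trans hR _.
apply: leq_trans (leq_mul (leqnn _) (leq_mul (leqnn _) hX)) _.
rewrite exponent_split // !expnD eq_leq //; move: (n ^ _) (n ^ _) (n ^ _) #|_| => a1 a2 a3 a4.
rewrite -!mulnA mulnCA; congr (M * _).
by rewrite [a2 * _]mulnCA mulnCA.
Qed.
End Step.

(** * The bound for all stages *)

Lemma class_bound (p d q : nat) : exists C : nat, forall q', q' <= q -> 0 < q' ->
  forall (k : fieldType) (T : finType) (G : {set {set T}}) (W : {set T}) (e : nat) (H : {set {set T}}),
  simplicial_complex G -> (forall F, F \in G -> #|F| <= d) ->
  links_acyclic k G p -> e + q' = p -> #|W| <= 2 * e ->
  common_class k G W e q' H ->
  #|H| ^ (2 ^ q'.-1) <= C ^ (2 ^ q'.-1) * #|T| ^ (q' * 2 ^ q'.-1).-1.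
Proof.
(* The induction is on an upper bound for [q'], because one step lowers [q'] by the variable amount
   [r.-1]. *)
elim: q => [|q [C IH]]; first by exists 0 => q' + q'0; rewrite leqNgt q'0.
(* The summands serve the step, the case of small [H], and the smaller values of [q']; [C.+1]
   replaces [C] to be positive. *)
pose C' := (step_const p d * C.+1 ^ (2 ^ p)).+1 + 4 * d + C; exists C'.
move=> q'; rewrite leq_eqVlt => /predU1P [->|]; last first.
  rewrite ltnS => qq q'0 k T G W e H cG dG aG eq cW HP.
  apply: leq_trans (IH q' qq q'0 k T G W e H cG dG aG eq cW HP) _.
  apply: leq_mul => //; rewrite leq_exp2r ?expn_gt0 //; exact: leq_addl.
move=> _ k T G W e H cG dG aG eq cW HP; set E := 2 ^ q.+1.-1; set n := #|T|.
have E0 : 0 < E by rewrite expn_gt0.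
have [H0|[S SH]] := set_0Vmem H; first by rewrite H0 cards0 exp0n.
have n0 : 0 < n.
  have [D [z [_ _ _ HS]]] := HP; have [cS _ _] := HS S SH.
  have /card_gt0P [v _] : 0 < #|S| by rewrite cS.
  by apply/card_gt0P; exists v.
have [small|big] := leqP #|H| (4 * d * n ^ q).
  apply: (@leq_trans ((4 * d * n ^ q) ^ E)); first by rewrite leq_exp2r.
  rewrite expnMn -expnM leq_mul //.
    by rewrite leq_exp2r // /C'; lia.
  by rewrite leq_pexp2l // mulSn; lia.
have [r [R [F0 [H' [r1 rq cWR [HP' h]]]]]] := descend cG dG aG (ltn0Sn q) eq cW HP big.
have ih : #|H'| ^ (2 ^ (q.+1 - r)) <=
    C.+1 ^ (2 ^ (q.+1 - r)) * n ^ ((q.+1 - r).+1 * 2 ^ (q.+1 - r)).-1.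
  have qr : (q.+1 - r).+1 <= q by lia.
  have := IH _ qr (ltn0Sn _) k T (link G F0) _ _ H' (link_complex cG) _ (links_acyclic_link cG aG) _ cWR HP'.
  move=> /(_ _ _)/leq_trans; apply.
  - by move=> F /(sub_link cG)/dG.
  - by lia.
  - by apply: leq_mul => //; rewrite leq_exp2r ?expn_gt0.
apply: leq_trans (exponent_step n0 r1 rq _ h ih) _; first by rewrite expn_gt0.
apply: leq_mul => //; rewrite leq_exp2r // /C' -addnA.
apply: leq_trans (leq_addr _ _); rewrite ltnS leq_mul2l; apply/orP; right.
by rewrite leq_pexp2l // leq_exp2l //; lia.
Qed.

(** The initial stage: on no vertices each link is the complex [{set0}], and the empty face spans
    its reduced homology in dimension -1. *)
Lemma faces_common_class (k : fieldType) (T : finType) (G : {set {set T}}) (q : nat) :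
  simplicial_complex G -> common_class k G set0 0 q (faces_sz G q).
Proof.
move=> cG; exists [set set0], [ffun A : {set T} => (A == set0)%:R%R]; split.
- move=> A; rewrite ffunE inE; have [->|_] := eqVneq A set0; last by rewrite eqxx.
  by rewrite cards0.
- apply/ffunP => A; rewrite !ffunE big1 // => v _; rewrite ffunE.
  by rewrite setU_eq0 -cards_eq0 cards1 GRing.mulr0.
- move=> c con cE.
  have c0 : c = 0%R.
    apply/ffunP => A; rewrite [RHS]ffunE; apply/eqP/negPn/negP => /con [].
    by rewrite inE => /eqP ->; rewrite cards0.
  move: cE; rewrite c0 bnd0 => /ffunP/(_ set0); rewrite !ffunE eqxx => /eqP.
  by rewrite eq_sym GRing.oner_eq0.
- move=> S; rewrite inE => /andP [SG /eqP cS]; split=> //.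
    by rewrite -setI_eq0 setI0.
  apply/setP => A; rewrite [RHS]inE; apply/inducedP/eqP => [[_]|->].
    by rewrite subset0 => /eqP.
  split=> //; apply/linkP; rewrite set0U; split=> //.
  by rewrite -setI_eq0 set0I.
Qed.

(* From here on [<=] and [^] on nat are Stdlib's, hence the prefix [leq] and [expn]. *)
From Stdlib Require Import Reals Lra.

(** * Real exponents and the final bound *)

Lemma INR_expn (n m : nat) : INR (expn n m) = (INR n ^ m)%R.
Proof. by elim: m => [|m IH]; rewrite ?expn0 // expnS mult_INR IH. Qed.

Lemma real_root_bound (f C n p E : nat) : leq 1 E -> leq 2 (muln p E) ->
  leq (expn f E) (muln (expn C E) (expn n (muln p E).-1)) ->
  (INR f <= INR C * Rpower (INR n) (INR p - / INR E))%R.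
Proof.
(* For [n = 0] the exponent [(p * E).-1] is positive, so [h] forces [f = 0], and the right side is
   nonnegative whatever the value of [Rpower] at 0. *)
move=> E0 pE h; have [n0|n0] := posnP n.
  have -> : f = 0.
    apply/eqP; rewrite -leqn0 -(leq_exp2r _ _ E0) exp0n //.
    by apply: leq_trans h _; rewrite n0 exp0n ?muln0 //; lia.
  by apply: Rmult_le_pos; [apply: pos_INR | apply/Rlt_le/exp_pos].
set x := Rpower _ _.
have nR : (0 < INR n)%R by apply: lt_0_INR; apply/ltP.
have ER : (0 < INR E)%R by apply: lt_0_INR; apply/ltP.
have xE : (x ^ E = INR n ^ (p * E).-1)%R.
  rewrite -Rpower_pow; last exact: exp_pos.
  rewrite Rpower_mult -Rpower_pow //; congr Rpower.
  rewrite -subn1 minus_INR; last by apply/leP; lia.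
  by rewrite mult_INR /=; field; lra.
have hR : (INR f ^ E <= (INR C * x) ^ E)%R.
  rewrite Rpow_mult_distr xE -!INR_expn -mult_INR.
  by apply: le_INR; apply/leP.
apply: Rnot_lt_le => lt.
have Cx : (0 <= INR C * x)%R by apply: Rmult_le_pos; [apply: pos_INR | apply/Rlt_le/exp_pos].
have : forall m, leq 1 m -> ((INR C * x) ^ m < INR f ^ m)%R.
  case=> // m _; elim: m => [|m IH]; first by rewrite !pow_1.
  rewrite -!(tech_pow_Rmult _ m.+1); apply: Rmult_le_0_lt_compat => //.
  exact: pow_le.
by move/(_ E E0); lra.
Qed.

Theorem mainTheorem13 (p d : nat) :
  2 <= p -> 1 <= d ->
  exists C : R,
    forall (k : fieldType) (T : finType) (G : {set {set T}}),
      simplicial_complex G ->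
      has_max_face_size G d ->
      girth_gt k G p.-1 (2 * p) ->
      (INR (fvec G p.-1) <= bound_rhs C #|T| p)%R.
Proof.
move=> p2 _; have [C CP] := class_bound p d p; exists (INR C) => k T G cG [dG _] gG.
case: p p2 CP gG => // p p2 CP gG; rewrite /= in gG.
have ac := girth_links_acyclic cG gG.
(* The induction starts at [e = 0] with [W] empty and [H] all faces of the given size. *)
have := CP p.+1 (leqnn _) isT k T G set0 0 (faces_sz G p.+1) cG dG ac erefl _ (faces_common_class k p.+1 cG).
rewrite cards0 => /(_ isT) h.
have := real_root_bound _ _ h; rewrite /bound_rhs subn1 INR_expn; apply.
  by rewrite expn_gt0.
by rewrite (leq_trans p2) // leq_pmulr // expn_gt0.
Qed.
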